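(* Let $p_1, p_{er} \ge 0$ satisfy $2p_1 + p_{er} < 1$. There are constants $M_0 = M_0(p_1,p_{er}) \ge 1$ and $K_0 = K_0(p_1,p_{er}) \ge 1$ such that the following holds for all $M \ge M_0$ and all integers $k \ge K_0$ for which $r = r(k) = M \log k$ is a positive integer: for the $r$-repetition code on $k$ message bits, sent through the channel with parameters $p_1, p_{er}$ described in the context, the decoding error probability $P_k = \mathbb{P}(X \neq \hat{X})$ with the majority decision rule satisfies $$P_k \le \frac{1}{k}.$$
   Context: All logarithms are to base $2$. Message: $X = (X_1,\ldots,X_k)$ has i.i.d. bits with $\mathbb{P}(X_i=0)=\mathbb{P}(X_i=1)=\frac12$. $r$-repetition code: each message bit $X_i$ is transmitted together with $r$ parity bits that are copies of it; that is, for $1 \le i \le k$ the bits $Z_i(0), Z_i(1),\ldots,Z_i(r)$ are transmitted, where $Z_i(j) = X_i$ for all $0 \le j \le r$ ($Z_i(0)$ being the message bit itself). Channel: each transmitted bit is, independently of all other bits and of the message, erased (received as the erasure symbol $\alpha_{er} \notin \{0,1\}$) with probability $p_{er}$, flipped (the bit $b$ is received as $1-b$) with probability $p_1$, and received unchanged with probability $1-p_1-p_{er}$. Let $\tilde{Z}_i(j)$ denote the received symbol corresponding to $Z_i(j)$. Majority decision rule: for $1 \le i \le k$ and $l \in \{0,1\}$, let $W_l(i) = \{ j \in \{0,1,\ldots,r\} : \tilde{Z}_i(j) = l\}$. If $\# W_1(i) \ge \# W_0(i)$ set $\hat{X}_i = 1$; otherwise set $\hat{X}_i = 0$. The estimated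 message is $\hat{X} = (\hat{X}_1,\ldots,\hat{X}_k)$. *)

(* Defs.v *)
From HB Require Import structures.
From mathcomp Require Import all_boot all_order all_algebra.
From mathcomp Require Import all_classical all_reals all_analysis.

Set Implicit Arguments.
Unset Strict Implicit.
Unset Printing Implicit Defensive.

Import Order.TTheory GRing.Theory Num.Theory.

Local Open Scope classical_set_scope.
Local Open Scope ring_scope.

Definition log2 (R : realType) (x : R) : R := ln x / ln 2.

Inductive noise := Intact | Flipped | Erased.

(* The coding into ordinals only serves to obtain the discrete measurable space
   noise. *)
Definition noise_code (e : noise) : 'I_3 :=
  match e with Intact => inord 0 | Flipped => inord 1 | Erased => inord 2 end.

Definition noise_decode (i : 'I_3) : noise :=
  match val i with 0%N => Intact | 1%N => Flipped | _ => Erased end.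

Lemma noise_codeK : cancel noise_code noise_decode.
Proof. by case; rewrite /noise_decode /= inordK. Qed.

HB.instance Definition _ := Finite.copy noise (can_type noise_codeK).
HB.instance Definition _ := isPointed.Build noise Intact.
HB.instance Definition _ := @isMeasurable.Build default_measure_display
  noise discrete_measurable discrete_measurable0
  discrete_measurableC discrete_measurableU.

(* Received symbols live in option bool; None is the erasure symbol. *)
Definition channel_output (b : bool) (e : noise) : option bool :=
  match e with
  | Intact => Some b
  | Flipped => Some (~~ b)
  | Erased => None
  end.

Definition repetition_code (k r : nat) (x : {ffun 'I_k -> bool})
  (i : 'I_k) (j : 'I_r.+1) : bool := x i.

(* The set of all j such that z i j is the unerased bit l. *)
Definition votes (k r : nat) (z : 'I_k -> 'I_r.+1 -> option bool)
  (l : bool) (i : 'I_k) : {set 'I_r.+1} := [set j | z i j == Some l]%SET.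

(* Ties are decoded as 1. *)
Definition majority_decode (k r : nat) (z : 'I_k -> 'I_r.+1 -> option bool) :
  {ffun 'I_k -> bool} :=
  [ffun i => (#|votes z true i| >= #|votes z false i|)%N].

Section Transmission.
Context (d : measure_display) (T : measurableType d) (R : realType).
Variable P : probability T R.

Definition mutually_independent (I : finType) (G : I -> set_system T) : Prop :=
  forall (J : {set I}) (A : I -> set T),
    (forall i, i \in J -> G i (A i)) ->
    P (\bigcap_(i in [set` J]) A i) = (\prod_(i in J) P (A i))%E.

Definition generated_sigma_algebra d' (V : measurableType d') (Y : T -> V) :
  set_system T := preimage_set_system setT Y measurable.

Variables (k r : nat).
Variables (X : 'I_k -> {RV P >-> bool}) (N : 'I_k -> 'I_r.+1 -> {RV P >-> noise}).

Definition message (w : T) : {ffun 'I_k -> bool} := [ffun i => X i w].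

Definition received (w : T) (i : 'I_k) (j : 'I_r.+1) : option bool :=
  channel_output (repetition_code (message w) i j) (N i j w).

Definition source_and_noise (s : 'I_k + 'I_k * 'I_r.+1) : set_system T :=
  match s with
  | inl i => generated_sigma_algebra (X i)
  | inr (i, j) => generated_sigma_algebra (N i j)
  end.

Record repetition_transmission (p1 per : R) : Prop := {
  message_uniform : forall i b, P [set w | X i w = b] = (1 / 2)%:E ;
  noise_flip : forall i j, P [set w | N i j w = Flipped] = p1%:E ;
  noise_erase : forall i j, P [set w | N i j w = Erased] = per%:E ;
  noise_intact : forall i j, P [set w | N i j w = Intact] = (1 - p1 - per)%:E ;
  source_noise_indep : mutually_independent source_and_noise
}.

Definition decoding_error : \bar R :=
  P [set w | message w != majority_decode (received w)].

End Transmission.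

(* Main.v *)
Require Import Defs.
From mathcomp Require Import all_boot all_order all_algebra.
From mathcomp Require Import all_classical all_reals all_analysis.
From mathcomp Require Import ring lra.
Import Order.TTheory GRing.Theory Num.Theory.
Local Open Scope ring_scope.

(** Write q for 1 - p1 - per. Only the noise matters: the i-th bit can be
    decoded wrongly only if, among its r + 1 copies, at least as many are
    flipped as arrive intact ([majority_decode_wrong]). Since p1 < q this is a
    large deviation, and it is controlled by Chernoff's method: give an intact
    copy the weight 1/s, a flipped copy the weight s and an erased copy the
    weight 1, for some s > 1. A noise pattern with at least as many flipped
    as intact copies has a product of weights that is at least 1, so its
    probability is at most its weighted probability; and by independence the
    weighted probabilities of all patterns sum up to theta ^ (r + 1), where
    theta = q / s + p1 * s + per. For s slightly above 1 one has theta < 1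
    ([exists_contracting_tilt]), because the derivative of theta in s is
    p1 - q < 0 at s = 1.

    The union bound over the k message bits gives the error bound
    k * theta ^ (r + 1) ([decoding_error_le]). With r = M log k, the power
    theta ^ r equals k to the exponent M log theta, which is at most k ^ -2
    as soon as M >= - 2 / log theta ([repetitions_suffice]). *)

(** * Finite unions and finitely-valued random variables *)

Lemma probability_finite_union (d : measure_display) (T : measurableType d)
    (R : realType) (P : probability T R) (I : finType) (p : pred I)
    (A : set T) (B : I -> set T) :
  (forall i, p i -> measurable (B i)) -> measurable A ->
  (forall w, A w -> exists2 i, p i & B i w) ->
  (P A <= \sum_(i | p i) P (B i))%E.
Proof.
move=> mB mA sAB; rewrite -big_enum fsbig_seq ?enum_uniq //.
apply: content_sub_fsum => //.
- by move=> i /=; rewrite mem_enum => /mB.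
- by move=> w /sAB[i pi Bi]; exists i => //=; rewrite mem_enum.
Qed.

Lemma measurable_preimage_finite (d : measure_display) (T : measurableType d)
    (V : finType) (g : T -> V) :
  (forall v, measurable [set w | g w = v]%classic) ->
  forall Q : pred V, measurable [set w | Q (g w)]%classic.
Proof.
move=> mg Q.
have -> : [set w | Q (g w)]%classic =
    (\bigcup_(v in [set` Q]) [set w | g w = v])%classic.
  by apply/seteqP; split=> [w Qw|w [v Qv /= ->]] //; exists (g w).
by apply: fin_bigcup_measurable => // v _.
Qed.

Lemma measurable_forall (d : measure_display) (T : measurableType d)
    (I : finType) (B : I -> set T) :
  (forall i, measurable (B i)) -> measurable [set w | forall i, B i w]%classic.
Proof.
move=> mB.
have -> : [set w | forall i, B i w]%classic =
    (\bigcap_(i in [set: I]) B i)%classic.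
  by apply/seteqP; split=> w h i //; exact: h.
by apply: fin_bigcap_measurable => // i _; exact: mB.
Qed.

(** * Weighted noise patterns *)

(** The equality test of noise is transported along [noise_code], whose values
    [inord] do not reduce; this form does. *)
Lemma noise_eqE (x y : noise) :
  (x == y) = match x, y with
             | Intact, Intact | Flipped, Flipped | Erased, Erased => true
             | _, _ => false
             end.
Proof. by apply/eqP; case: x; case: y. Qed.

Lemma sum_noise (R : nmodType) (f : noise -> R) :
  \sum_(x : noise) f x = f Intact + f Flipped + f Erased.
Proof.
rewrite (bigD1 Intact) //= (bigD1 Flipped) ?noise_eqE //=.
rewrite (bigD1 Erased) ?noise_eqE //= big1 ?addr0 ?addrA // => x.
by rewrite !noise_eqE; case: x.
Qed.

Definition noise_prob {R : realType} (p1 per : R) (x : noise) : R :=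
  match x with
  | Intact => 1 - p1 - per
  | Flipped => p1
  | Erased => per
  end.

Definition tilt {R : realType} (s : R) (x : noise) : R :=
  match x with Intact => s^-1 | Flipped => s | Erased => 1 end.

(** An intact copy votes for the sent bit and a flipped copy against it,
    whichever the sent bit is; its value only decides how a tie is resolved,
    and the weak inequality covers both cases. *)
Lemma majority_decode_wrong (k r : nat) (x : {ffun 'I_k -> bool})
    (e : 'I_k -> 'I_r.+1 -> noise) (i : 'I_k) :
  majority_decode
    (fun i j => channel_output (repetition_code x i j) (e i j)) i != x i ->
  (#|[set j | e i j == Intact]%SET| <= #|[set j | e i j == Flipped]%SET|)%N.
Proof.
have same l : l = x i -> votes (fun i j =>
    channel_output (repetition_code x i j) (e i j)) l i
    = [set j | e i j == Intact]%SET.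
  move=> ->; apply/setP => j; rewrite !inE noise_eqE /repetition_code.
  by case: (e i j) => //=; case: (x i).
have opposite l : l = ~~ x i -> votes (fun i j =>
    channel_output (repetition_code x i j) (e i j)) l i
    = [set j | e i j == Flipped]%SET.
  move=> ->; apply/setP => j; rewrite !inE noise_eqE /repetition_code.
  by case: (e i j) => //=; case: (x i).
rewrite ffunE; case xi: (x i) same opposite => same opposite.
- by rewrite (same true) // (opposite false) // eqb_id -ltnNge => /ltnW.
- by rewrite (same false) // (opposite true) // eqbF_neg negbK.
Qed.

Lemma prod_tilt_ge1 (R : realType) (s : R) (J : finType) (e : J -> noise) :
  1 <= s ->
  (#|[set j | e j == Intact]%SET| <= #|[set j | e j == Flipped]%SET|)%N ->
  1 <= \prod_j tilt s (e j).
Proof.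
move=> s1 le_e; have s0 : 0 < s by apply: lt_le_trans s1.
have -> : \prod_j tilt s (e j) =
    (\prod_(j in [set j | e j == Flipped]%SET) s) *
    (\prod_(j in [set j | e j == Intact]%SET) s^-1).
  rewrite [X in X * _]big_mkcond [X in _ * X]big_mkcond -big_split /=.
  apply: eq_bigr => j _; rewrite !inE !noise_eqE.
  by case: (e j) => /=; rewrite ?mul1r ?mulr1.
rewrite !prodr_const exprVn ler_pdivlMr ?exprn_gt0 // mul1r.
exact: ler_weXn2l.
Qed.

(** The Chernoff bound for the bad patterns: their indicator is dominated by
    the product of the weights, which factorizes over the copies. *)
Lemma sum_bad_patterns_le (R : realType) (p1 per s : R) (n : nat) :
  0 <= p1 -> 0 <= per -> 0 <= 1 - p1 - per -> 1 <= s ->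
  \sum_(e : {ffun 'I_n -> noise} |
      (#|[set j | e j == Intact]%SET| <= #|[set j | e j == Flipped]%SET|)%N)
    \prod_j noise_prob p1 per (e j)
  <= ((1 - p1 - per) / s + p1 * s + per) ^+ n.
Proof.
move=> p1_ge0 per_ge0 q_ge0 s1; have s0 : 0 < s by apply: lt_le_trans s1.
have prob_ge0 x : 0 <= noise_prob p1 per x by case: x.
have tilt_ge0 x : 0 <= tilt s x by case: x => /=; rewrite ?invr_ge0 ?ltW.
pose wt x := noise_prob p1 per x * tilt s x.
have -> : ((1 - p1 - per) / s + p1 * s + per) ^+ n =
    \sum_(e : {ffun 'I_n -> noise}) \prod_j wt (e j).
  rewrite -(bigA_distr_bigA (fun _ : 'I_n => wt)) /= prodr_const card_ord.
  by rewrite sum_noise /wt /= mulr1.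
rewrite [leLHS]big_mkcond; apply: ler_sum => e _; rewrite big_split /=.
case: ifP => [bad|_]; last by rewrite mulr_ge0 // prodr_ge0.
by rewrite ler_peMr ?prod_tilt_ge1 // prodr_ge0.
Qed.

Lemma exists_contracting_tilt (R : realType) (p1 per : R) :
  0 <= p1 -> 0 <= per -> 2 * p1 + per < 1 ->
  exists2 s, 1 <= s & 0 < (1 - p1 - per) / s + p1 * s + per < 1.
Proof.
move=> p1_ge0 per_ge0 hp; set q := 1 - p1 - per.
(* For s > 1, the inequality q / s + p1 * s < q + p1 means p1 * s < q; since
   p1 <= 1, this holds when s - 1 is at most half of q - p1. *)
exists (1 + (q - p1) / 2); first by rewrite /q; lra.
set s := 1 + (q - p1) / 2.
have s1 : 1 < s by rewrite /s /q; lra.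
have s0 : 0 < s by apply: lt_trans s1.
have q0 : 0 < q by rewrite /q; lra.
have p1s : p1 * s < q.
  have p1_le1 : p1 <= 1 by lra.
  have : p1 * (q - p1) <= q - p1 by rewrite ler_piMl // /q; lra.
  by rewrite /s; rewrite /q; nra.
apply/andP; split.
  by rewrite ltr_wpDr // ltr_pwDl ?divr_gt0 // mulr_ge0 // ltW.
have : 0 < (q - p1 * s) * (s - 1) / s.
  by rewrite divr_gt0 // mulr_gt0 // subr_gt0.
have -> : (q - p1 * s) * (s - 1) / s = q + p1 - (q / s + p1 * s).
  by field; rewrite gt_eqF.
have -> : q + p1 = 1 - per by rewrite /q; ring.
lra.
Qed.

(** * The decoding error *)

Section DecodingError.
Context (d : measure_display) (T : measurableType d) (R : realType).
Context (P : probability T R) (k r : nat).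
Context (X : 'I_k -> {RV P >-> bool}) (N : 'I_k -> 'I_r.+1 -> {RV P >-> noise}).

Lemma measurable_noise_eq i j x : measurable [set w | N i j w = x]%classic.
Proof. exact: (measurable_funPTI (N i j) (Y := [set x]%classic)). Qed.

(** Membership in the error event is read off from finitely many discrete
    variables. Its measurability is what lets a covering bound its
    probability. *)
Lemma measurable_decoding_error :
  measurable [set w | message X w != majority_decode (received X N w)]%classic.
Proof.
pose g w := (message X w, [ffun ij : 'I_k * 'I_r.+1 => N ij.1 ij.2 w]).
have mg v : measurable [set w | g w = v]%classic.
  have -> : [set w | g w = v]%classic =
      ([set w | forall i, X i w = v.1 i] `&`
       [set w | forall ij, N ij.1 ij.2 w = v.2 ij])%classic.
    apply/seteqP; split=> [w <-|w [h1 h2]] /=.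
      by split=> a; rewrite ffunE.
    rewrite /g; case: v h1 h2 => v1 v2 /= h1 h2.
    by congr pair; apply/ffunP => a; rewrite ffunE.
  apply: measurableI; apply: measurable_forall => a.
    exact: (measurable_funPTI (X a) (Y := [set v.1 a]%classic)).
  exact: measurable_noise_eq.
pose Q (v : {ffun 'I_k -> bool} * {ffun 'I_k * 'I_r.+1 -> noise}) :=
  v.1 != majority_decode (fun i j =>
    channel_output (repetition_code v.1 i j) (v.2 (i, j))).
have -> : [set w | message X w != majority_decode (received X N w)]%classic
    = [set w | Q (g w)]%classic.
  congr mkset; apply/funext => w; rewrite /Q /=.
  do 4 congr (_ _); apply/funext => i; apply/funext => j.
  by rewrite ffunE.
exact: measurable_preimage_finite.
Qed.

Lemma noise_pattern_probability (p1 per : R) (i : 'I_k)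
    (e : {ffun 'I_r.+1 -> noise}) :
  repetition_transmission X N p1 per ->
  P [set w | forall j, N i j w = e j]%classic =
  (\prod_j noise_prob p1 per (e j))%:E.
Proof.
move=> [_ flip erase intact indep].
pose row j : 'I_k + 'I_k * 'I_r.+1 := inr (i, j).
(* The index set below contains no message bit, so setT is a dummy value. *)
pose A (t : 'I_k + 'I_k * 'I_r.+1) : set T :=
  match t with
  | inl _ => setT
  | inr (a, j) => [set w | N a j w = e j]%classic
  end.
have -> : [set w | forall j, N i j w = e j]%classic =
    (\bigcap_(t in [set` [set row j | j in 'I_r.+1]%SET]) A t)%classic.
  apply/seteqP; split=> [w h t /= /imsetP[j _ ->]|w h j] //=.
  by apply: (h (row j)) => /=; apply: imset_f.
rewrite indep; last first.
  move=> _ /imsetP[j _ ->] /=; exists [set e j]%classic => //.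
  by rewrite setTI.
rewrite big_imset /=; last by move=> a b _ _ [].
rewrite -prodEFin; apply: eq_bigr => j _.
by case: (e j) => /=; [exact: intact|exact: flip|exact: erase].
Qed.

(** Union bound over all pairs of a message bit and a noise pattern of its
    copies that could make the decoder err on it. *)
Lemma decoding_error_le (p1 per s : R) :
  0 <= p1 -> 0 <= per -> 0 <= 1 - p1 - per -> 1 <= s ->
  repetition_transmission X N p1 per ->
  (decoding_error X N <=
     (k%:R * ((1 - p1 - per) / s + p1 * s + per) ^+ r.+1)%:E)%E.
Proof.
move=> p1_ge0 per_ge0 q_ge0 s1 tr.
pose bad (e : {ffun 'I_r.+1 -> noise}) :=
  (#|[set j | e j == Intact]%SET| <= #|[set j | e j == Flipped]%SET|)%N.
pose B (ie : 'I_k * {ffun 'I_r.+1 -> noise}) : set T :=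
  [set w | forall j, N ie.1 j w = ie.2 j]%classic.
apply: (@le_trans _ _ (\sum_(ie | bad ie.2) P (B ie))%E).
  apply: probability_finite_union; last 1 first.
  - move=> w /= err.
    have [i wrong] : exists i,
        majority_decode (received X N w) i != message X w i.
      apply/existsP; apply: contraNT err => /existsPn right.
      by apply/eqP/ffunP => i; move: (right i); rewrite negbK => /eqP.
    exists (i, [ffun j => N i j w]); last by move=> j; rewrite ffunE.
    move: (majority_decode_wrong k r (message X w)
      (fun i j => N i j w) i wrong).
    have patternE x : [set j | [ffun j => N i j w] j == x]%SET
        = [set j | N i j w == x]%SET by apply/setP => j; rewrite !inE ffunE.
    by rewrite /bad /= !patternE.
  - by move=> ie _; apply: measurable_forall => j; exact: measurable_noise_eq.
  - exact: measurable_decoding_error.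
under eq_bigr do rewrite (noise_pattern_probability p1 per) //.
rewrite sumEFin lee_fin.
rewrite -(pair_big xpredT bad
  (fun _ e => \prod_j noise_prob p1 per (e j))) /=.
rewrite sumr_const card_ord -[leLHS]mulr_natl ler_wpM2l ?ler0n //.
exact: sum_bad_patterns_le.
Qed.

End DecodingError.

(** * The number of repetitions *)

(** The hypothesis on M makes r * (- ln theta) at least 2 * ln k. *)
Lemma repetitions_suffice (R : realType) (theta M : R) (k r : nat) :
  0 < theta < 1 -> 2 * ln 2 / - ln theta <= M -> (0 < k)%N ->
  r%:R = M * log2 (k%:R : R) -> k%:R * theta ^+ r.+1 <= 1 / k%:R.
Proof.
move=> /andP[th0 th1] leM k_gt0 rE.
have k0 : (0 : R) < k%:R by rewrite ltr0n.
have lnk_ge0 : 0 <= ln (k%:R : R) by rewrite ln_ge0 // ler1n.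
have ln2_gt0 : 0 < ln (2 : R) by rewrite ln_gt0 // ltr1n.
have lnth : 0 < - ln theta by rewrite oppr_gt0 ln_lt0 // th0.
rewrite ler_pdivlMr //.
apply: (@le_trans _ _ (k%:R ^+ 2 * theta ^+ r)).
  rewrite mulrAC -expr2 ler_wpM2l ?exprn_ge0 ?ler0n //.
  by rewrite exprS ler_piMl ?exprn_ge0 ?(ltW th0) ?(ltW th1).
have pos : 0 < k%:R ^+ 2 * theta ^+ r by rewrite mulr_gt0 ?exprn_gt0.
rewrite -ler_ln ?posrE // ln1 lnM ?posrE ?exprn_gt0 // !lnXn //.
rewrite -[ln theta *+ r]mulr_natl rE /log2.
rewrite ler_pdivrMr // in leM.
have : 2 * ln 2 * (ln k%:R / ln 2) <= M * - ln theta * (ln k%:R / ln (2 : R)).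
  by rewrite ler_wpM2r // divr_ge0 // ltW.
have -> : 2 * ln 2 * (ln k%:R / ln 2) = 2 * ln (k%:R : R).
  by field; rewrite gt_eqF.
lra.
Qed.

Theorem proposition1 (R : realType) (p1 per : R)
    (p1_ge0 : 0 <= p1) (per_ge0 : 0 <= per) (hp : 2 * p1 + per < 1) :
  exists M0 K0 : R, [/\ 1 <= M0, 1 <= K0 &
    forall (M : R) (k r : nat),
      M0 <= M -> K0 <= k%:R -> (0 < r)%N -> r%:R = M * log2 (k%:R : R) ->
    forall (d : measure_display) (T : measurableType d) (P : probability T R)
      (X : 'I_k -> {RV P >-> bool}) (N : 'I_k -> 'I_r.+1 -> {RV P >-> noise}),
      repetition_transmission X N p1 per ->
      (decoding_error X N <= (1 / k%:R)%:E)%E].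
Proof.
have [s s1 theta01] := exists_contracting_tilt R p1 per p1_ge0 per_ge0 hp.
set theta := (_ + per) in theta01.
exists (Num.max 1 (2 * ln 2 / - ln theta)), 1; split => //.
  by rewrite le_max lexx.
move=> M k r; rewrite ge_max => /andP[_ leM] k1 _ rE d T P X N tr.
have q_ge0 : 0 <= 1 - p1 - per by lra.
apply: le_trans
  (decoding_error_le _ _ _ _ _ _ X N p1 per s p1_ge0 per_ge0 q_ge0 s1 tr) _.
rewrite lee_fin; apply: (repetitions_suffice R theta M) => //.
by rewrite -(ler1n R).
Qed.
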